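(* Let $n\ge2$ and let $a=\sum_{\alpha\in I(\mathbb{KP}_n)}a_\alpha\chi_\alpha\in C(\mathbb{KP}_n)$ (with $a_\alpha\in\mathbb C$) be such that $\mathcal F(a)$ is a state. The random walk $(\mathcal F(a)^{\star k})_{k\in\mathbb N}$ converges to the Haar state $\int_{\mathbb{KP}_n}$ if and only if $$\forall\alpha\in I(\mathbb{KP}_n)\setminus\{\rho_0^+\},\quad|a_\alpha|<d_\alpha.$$
   Context: Sekine quantum group $\mathbb{KP}_n$ ($n\ge2$). Put $\eta=e^{2\imath\pi/n}$; all indices are taken modulo $n$. $C(\mathbb{KP}_n)=\bigoplus_{i,j\in\mathbb Z_n}\mathbb C e_{(i,j)}\oplus M_n(\mathbb C)$ as a $*$-algebra, where the $e_{(i,j)}$ are the units of the one-dimensional summands and $E_{i,j}$ ($1\le i,j\le n$) are matrix units of $M_n(\mathbb C)$. The coproduct is $\Delta(e_{(i,j)})=\sum_{s,t\in\mathbb Z_n}e_{(s,t)}\otimes e_{(i-s,j-t)}+\frac1n\sum_{m,r=1}^n\eta^{i(m-r)}E_{m,r}\otimes E_{m+j,r+j}$, $\Delta(E_{i,j})=\sum_{s,t\in\mathbb Z_n}\eta^{s(i-j)}e_{(-s,-t)}\otimes E_{i-t,j-t}+\sum_{s,t\in\mathbb Z_n}\eta^{s(j-i)}E_{i-t,j-t}\otimes e_{(s,t)}$. The Haar state is $\int_{\mathbb{KP}_n}\big(\sum x_{(i,j)}e_{(i,j)}+\sum X_{i,j}E_{i,j}\big)=\frac1{2n^2}\big(\sum_{i,j}x_{(i,j)}+n\sum_iX_{i,i}\big)$.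 For $x\in C(\mathbb{KP}_n)$, $\mathcal F(x)$ is the linear functional $y\mapsto\int_{\mathbb{KP}_n}yx$. The convolution of functionals is $\phi\star\psi=(\phi\otimes\psi)\circ\Delta$, and $\phi^{\star k}$ is the $k$-fold convolution power. A state is a positive unital linear functional. Convergence is in the finite-dimensional dual space of $C(\mathbb{KP}_n)$ (equivalently, for $\lVert\phi-\psi\rVert_{QTV}=\sup_{p\text{ projection}}|\phi(p)-\psi(p)|$). Irreducible representations: $I(\mathbb{KP}_n)$ is the set of (classes of) irreducible representations, $d_\alpha$ is the dimension and $\chi_\alpha$ the character of $\alpha$. It consists of the one-dimensional $\rho_l^\pm=\sum_{i,j}\eta^{il}e_{(i,j)}\pm\sum_{m=1}^nE_{m,m+l}$ ($l\in\mathbb Z_n$; $\rho_0^+$ is the unit), the two-dimensional $\mathfrak X^{u,v}$ ($u\in\mathbb Z_n$, $1\le v\le\lfloor\frac{n-1}2\rfloor$) with characters $2\sum_{s,t\in\mathbb Z_n}\eta^{su}\cos(\frac{2tv\pi}n)e_{(s,t)}$, and, if $n$ is even, also the one-dimensional $\sigma_l^\pm=\sum_{i,j}(-1)^j\eta^{il}e_{(i,j)}\pm\sum_{m=1}^n(-1)^mE_{m,m+l}$ ($l\in\mathbb Z_n$). *)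

(* Defs.v *)
From HB Require Import structures.
From mathcomp Require Import all_boot all_order all_algebra.
From mathcomp Require Import all_classical all_reals all_analysis.
From mathcomp Require Import complex.

Set Implicit Arguments.
Unset Strict Implicit.
Unset Printing Implicit Defensive.

Import Order.TTheory GRing.Theory Num.Theory.
Import numFieldNormedType.Exports.

Local Open Scope classical_set_scope.
Local Open Scope ring_scope.

(* Everything below is meant for 1 < n, where ['Z_n] is the ring Z/nZ.  All
   indices live in ['Z_n], so index arithmetic is modulo n; a sum over
   1 <= m <= n is a sum over ['Z_n], the index n being the element 0. *)

Section SekineQuantumGroup.
Variables (R : realType) (n : nat).
Local Notation C := R[i].

(* ['M_n(C)], with rows and columns indexed by ['Z_n]: (Zp_trunc n).+2 is n. *)
Local Notation Mat := 'M[C]_((Zp_trunc n).+2).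

(* C(KP_n): the ring structure is componentwise, i.e. pointwise on the first
   factor (the n^2 one-dimensional summands) and the matrix product on the
   second one. *)
Definition KP : Type := ({ffun 'Z_n * 'Z_n -> C} * Mat)%type.
HB.instance Definition _ := GRing.PzRing.on KP.
HB.instance Definition _ := GRing.Lmodule.on KP.

Definition star (x : KP) : KP :=
  ([ffun p => Num.conj (x.1 p)], (map_mx Num.conj x.2)^T).

Definition unit_e (i j : 'Z_n) : KP := ([ffun p => (p == (i, j))%:R], 0).
Definition unit_E (i j : 'Z_n) : KP := (0, delta_mx i j).

(* The linear basis of KP: [inl (i, j)] stands for e_(i,j) and [inr (i, j)]
   for E_{i,j}. *)
Definition KP_idx : finType := ('Z_n * 'Z_n + 'Z_n * 'Z_n)%type.

Definition KP_basis (b : KP_idx) : KP :=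
  match b with
  | inl (i, j) => unit_e i j
  | inr (i, j) => unit_E i j
  end.

Definition KP_coord (x : KP) (b : KP_idx) : C :=
  match b with
  | inl (i, j) => x.1 (i, j)
  | inr (i, j) => x.2 i j
  end.

(* The tensor square of KP, given by coordinates in the basis
   (KP_basis b (x) KP_basis c)_(b, c). *)
Definition KP2 := {ffun KP_idx * KP_idx -> C}.

Definition tens (x y : KP) : KP2 :=
  [ffun bc => KP_coord x bc.1 * KP_coord y bc.2].

(* (phi (x) psi)(t), for linear functionals phi and psi. *)
Definition tens_form (phi psi : KP -> C) (t : KP2) : C :=
  \sum_bc t bc * (phi (KP_basis bc.1) * psi (KP_basis bc.2)).

(* exp(2 i pi / n) *)
Definition eta : C :=
  Complex (cos (2 * pi / n%:R)) (sin (2 * pi / n%:R)).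

(* Since eta ^+ n = 1, it may be raised to a power in ['Z_n]. *)
Definition eta_exp (k : 'Z_n) : C := eta ^+ (k : nat).

Definition Delta_e (i j : 'Z_n) : KP2 :=
  \sum_(s : 'Z_n) \sum_(t : 'Z_n) tens (unit_e s t) (unit_e (i - s) (j - t))
  + n%:R^-1 *: (\sum_(m : 'Z_n) \sum_(r : 'Z_n)
      eta_exp (i * (m - r)) *: tens (unit_E m r) (unit_E (m + j) (r + j))).

Definition Delta_E (i j : 'Z_n) : KP2 :=
  \sum_(s : 'Z_n) \sum_(t : 'Z_n)
    eta_exp (s * (i - j)) *: tens (unit_e (- s) (- t)) (unit_E (i - t) (j - t))
  + \sum_(s : 'Z_n) \sum_(t : 'Z_n)
    eta_exp (s * (j - i)) *: tens (unit_E (i - t) (j - t)) (unit_e s t).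

Definition Delta (x : KP) : KP2 :=
  \sum_(i : 'Z_n) \sum_(j : 'Z_n) x.1 (i, j) *: Delta_e i j
  + \sum_(i : 'Z_n) \sum_(j : 'Z_n) x.2 i j *: Delta_E i j.

Definition counit (x : KP) : C := x.1 (0, 0).

Definition haar (x : KP) : C :=
  (2 * n%:R ^+ 2)^-1 *
  (\sum_(i : 'Z_n) \sum_(j : 'Z_n) x.1 (i, j)
   + n%:R * \sum_(i : 'Z_n) x.2 i i).

Definition fourier (x : KP) : KP -> C := fun y => haar (y * x).

(* [0 <= z] in R[i] means that z is a nonnegative real number. *)
Definition is_state (phi : KP -> C) : Prop :=
  [/\ scalar phi, forall x, 0 <= phi (star x * x) & phi 1 = 1].

Definition convolution (phi psi : KP -> C) : KP -> C :=
  fun x => tens_form phi psi (Delta x).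

(* The 0-th power is the unit of the convolution algebra, i.e. the counit. *)
Definition conv_pow (phi : KP -> C) (k : nat) : KP -> C :=
  iterop k convolution phi counit.

(* Convergence in the dual space of KP: as KP is finite-dimensional, the
   topology of that space is the one of pointwise convergence.  [C^o] carries
   the usual topology of C, that of the norm of R[i]. *)
Definition dual_cvg (phi : nat -> KP -> C) (psi : KP -> C) : Prop :=
  forall x, (fun k => phi k x : C^o) @ \oo --> (psi x : C^o).

(* The set I(KP_n) of classes of irreducible representations.  The boolean is
   the sign: [false] for +, [true] for -. *)
Inductive KP_irr : Type :=
  | Rho of bool & 'Z_n
  | Xuv (u : 'Z_n) (v : 'I_n) of (1 <= v <= (n.-1)./2)%N
  | Sigma of ~~ odd n & bool & 'Z_n.

Local Notation irr_code :=
  (bool * 'Z_n + 'Z_n * {v : 'I_n | (1 <= v <= (n.-1)./2)%N}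
   + {_ : bool * 'Z_n | ~~ odd n})%type.

Definition encode_irr (al : KP_irr) : irr_code :=
  match al with
  | Rho s l => inl (inl (s, l))
  | Xuv u v hv => inl (inr (u, exist _ v hv))
  | Sigma hn s l => inr (exist _ (s, l) hn)
  end.

Definition decode_irr (c : irr_code) : KP_irr :=
  match c with
  | inl (inl (s, l)) => Rho s l
  | inl (inr (u, exist v hv)) => Xuv u hv
  | inr (exist (s, l) hn) => Sigma hn s l
  end.

Lemma encode_irrK : cancel encode_irr decode_irr.
Proof. by case. Qed.

HB.instance Definition _ := Finite.copy KP_irr (can_type encode_irrK).

Definition irr_dim (al : KP_irr) : nat := if al is Xuv _ _ _ then 2 else 1.

(* The parity of the representative of an element of ['Z_n] is used only for
   even n, where it does not depend on the representative. *)
Definition irr_char (al : KP_irr) : KP :=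
  match al with
  | Rho s l =>
      \sum_(i : 'Z_n) \sum_(j : 'Z_n) eta_exp (i * l) *: unit_e i j
      + (-1) ^+ s *: (\sum_(m : 'Z_n) unit_E m (m + l))
  | Xuv u v _ =>
      2 *: (\sum_(s : 'Z_n) \sum_(t : 'Z_n)
        (eta_exp (s * u)
         * Complex (cos (2 * (t : nat)%:R * (v : nat)%:R * pi / n%:R)) 0)
        *: unit_e s t)
  | Sigma _ s l =>
      \sum_(i : 'Z_n) \sum_(j : 'Z_n)
        ((-1) ^+ (j : nat) * eta_exp (i * l)) *: unit_e i j
      + (-1) ^+ s *: (\sum_(m : 'Z_n) (-1) ^+ (m : nat) *: unit_E m (m + l))
  end.

Definition irr_unit : KP_irr := Rho false 0.

End SekineQuantumGroup.

Arguments irr_char {R n} al.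
Arguments irr_dim {n} al.
Arguments irr_unit {n}.

(* Main.v *)
Require Import Defs.
From mathcomp Require Import all_boot all_order all_algebra.
From mathcomp Require Import all_classical all_reals all_analysis.
From mathcomp Require Import complex ring lra zify.

Set Implicit Arguments.
Unset Strict Implicit.
Unset Printing Implicit Defensive.

Import Order.TTheory GRing.Theory Num.Theory.
Import numFieldNormedType.Exports.
Local Open Scope ring_scope.

(** The elements [diag_coef u v] = sum eta^(su+tv) e_(s,t) and
    [off_coef u v] = sum eta^(mv) E_(m,m+u) form a basis on which the coproduct
    is that of matrix coefficients:
      Delta (diag_coef u v) = diag_coef u v (x) diag_coef u v
                              + off_coef u (-v) (x) off_coef u v,
      Delta (off_coef u v)  = diag_coef u (-v) (x) off_coef u v
                              + off_coef u v (x) diag_coef u v.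
    When 2v = 0 the combinations diag_coef + y off_coef with y^2 = 1 are
    group-like, so convolution powers of phi = F(a) evaluate on them as powers
    of a scalar.  When 2v <> 0, centrality of a gives phi (off_coef u v) = 0,
    so the same holds for diag_coef u v.  By orthogonality the scalar is
    a_alpha / d_alpha for the matching alpha, so the walk converges to the Haar
    state iff all these ratios, except the one at the unit (which is 1 because
    phi 1 = 1), have modulus less than 1. *)

(** * Powers of eta *)

Section RootOfUnity.
Variables (R : realType) (n : nat).
Hypothesis hn : (1 < n)%N.
Local Notation C := R[i].
Local Notation w := (@eta_exp R n).

Lemma eta_pow k : eta R n ^+ k =
  Complex (cos (2 * pi / n%:R * k%:R)) (sin (2 * pi / n%:R * k%:R)).
Proof.
elim: k => [|k IH]; first by rewrite mulr0 cos0 sin0 expr0.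
rewrite exprS IH /eta; set t := 2 * pi / n%:R.
rewrite -natr1 mulrDr mulr1 cosD sinD.
by apply/eqP; rewrite eq_complex /=; apply/andP; split; apply/eqP; ring.
Qed.

Lemma natn0 : (n%:R : R) != 0.
Proof. by rewrite pnatr_eq0 -lt0n ltnW. Qed.

Lemma natCn0 : (n%:R : C) != 0.
Proof. by rewrite pnatr_eq0 -lt0n ltnW. Qed.

Lemma eta_n : eta R n ^+ n = 1.
Proof.
rewrite eta_pow mulfVK ?natn0 //.
by rewrite mulr_natl cos2pi sin2pi.
Qed.

Lemma eta_mod k : eta R n ^+ (k %% n) = eta R n ^+ k.
Proof. by rewrite [in RHS](divn_eq k n) exprD mulnC exprM eta_n expr1n mul1r. Qed.

(** With s = pi k / n strictly between 0 and pi, sin s > 0, so the real part cos (2s) = 1 - 2 sin^2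
    s is less than 1. *)
Lemma eta_pow_neq1 k : (0 < k < n)%N -> eta R n ^+ k != 1.
Proof.
move=> /andP[k0 kn]; rewrite eta_pow; apply/eqP => -[+ _].
pose s : R := pi / n%:R * k%:R.
have -> : 2 * pi / n%:R * k%:R = s + s by rewrite /s; ring.
have n0 : (0 : R) < n%:R by rewrite ltr0n ltnW.
have s0 : 0 < sin s.
  apply: sin_gt0_pi; apply/andP; split.
    by rewrite mulr_gt0 ?divr_gt0 ?pi_gt0 ?ltr0n ?(ltnW hn).
  by rewrite /s -mulrA gtr_pMr ?pi_gt0// mulrC ltr_pdivrMr// mul1r ltr_nat.
have := cos2Dsin2 s; have : 0 < sin s ^+ 2 by rewrite exprn_gt0.
by rewrite cosD -!expr2; lra.
Qed.

Lemma eta_expE k : w k%:R = eta R n ^+ k.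
Proof. by rewrite /eta_exp val_Zp_nat // eta_mod. Qed.

Lemma eta_exp0 : w 0 = 1.
Proof. by rewrite -[0]/(0%:R) eta_expE. Qed.

Lemma eta_expD x y : w (x + y) = w x * w y.
Proof. by rewrite -[x]natr_Zp -[y]natr_Zp -natrD !eta_expE exprD. Qed.

Lemma eta_exp_neq1 x : x != 0 -> w x != 1.
Proof.
move=> x0; apply: eta_pow_neq1; apply/andP; split; first by rewrite lt0n.
by have := ltn_ord x; rewrite {2}Zp_cast.
Qed.

(** Orthogonality of the characters of Z/n: for x nonzero, shifting i by 1 multiplies the sum S by
    [w x], so ([w x] - 1) S = 0 with [w x] different from 1. *)
Lemma sum_eta_exp x : \sum_i w (i * x) = (x == 0)%:R * n%:R.
Proof.
have [->|x0] := eqVneq x 0.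
  rewrite (eq_bigr (fun=> 1)) => [|i _]; last by rewrite mulr0 eta_exp0.
  by rewrite sumr_const card_ord Zp_cast // mul1r.
rewrite mul0r; apply: (mulIf (x := w x - 1)); first by rewrite subr_eq0 eta_exp_neq1.
rewrite mul0r mulrBr mulr1; apply/eqP; rewrite subr_eq0; apply/eqP.
rewrite [RHS](reindex_inj (addIr 1)) mulr_suml; apply: eq_bigr => i _.
by rewrite -eta_expD mulrDl mul1r.
Qed.

(** The modulus of z is the image of a real r with |r| < 1, so the claim reduces to the real
    geometric sequence. *)
Lemma expr_cvg0 (z : C) :
  `|z| < 1 -> ((fun k => z ^+ k : C^o) @ \oo --> (0 : C^o))%classic.
Proof.
rewrite normc_def; set r := Num.sqrt _ => z1.
have r1 : `|r| < 1 by rewrite ger0_norm ?sqrtr_ge0 //; rewrite -ltcR.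
apply/cvgrPdist_lt => e e0.
have eE : e = (complex.Re e)%:C%C by rewrite RRe_real // gtr0_real.
have := cvg_expr r1 => /cvgrPdist_lt/(_ (complex.Re e)).
rewrite -ltcR -eE => /(_ e0); apply: filterS => k /=.
rewrite !sub0r !normrN !normrX normc_def -/r -rmorphXn /=.
by rewrite eE ltcR ger0_norm ?sqrtr_ge0.
Qed.

(** If |z| >= 1, every power has modulus at least 1, so none comes within distance 1 of 0. *)
Lemma expr_cvg0_lt1 (z : C) :
  ((fun k => z ^+ k : C^o) @ \oo --> (0 : C^o))%classic -> `|z| < 1.
Proof.
move=> /cvgrPdist_lt/(_ 1 ltr01) [N _ /(_ N (leqnn N))] /=.
rewrite sub0r normrN normrX => h; rewrite real_ltNge ?normr_real ?real1//.
by apply: contraTN h => z1; rewrite -real_leNgt ?exprn_ege1 ?rpredX ?normr_real ?real1.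
Qed.
End RootOfUnity.

(** * Convolution on matrix coefficients *)

Lemma scalar_formD {K : pzRingType} {V : lmodType K} (phi : V -> K) x y :
  scalar phi -> phi (x + y) = phi x + phi y.
Proof. by move=> hphi; rewrite -[x]scale1r hphi mul1r scale1r. Qed.

Lemma scalar_form0 {K : pzRingType} {V : lmodType K} (phi : V -> K) :
  scalar phi -> phi 0 = 0.
Proof. by move=> h; apply: (addrI (phi 0)); rewrite -scalar_formD // !addr0. Qed.

Lemma scalar_formZ {K : pzRingType} {V : lmodType K} (phi : V -> K) k x :
  scalar phi -> phi (k *: x) = k * phi x.
Proof. by move=> h; rewrite -[k *: x]addr0 h scalar_form0 // addr0. Qed.

Lemma scalar_form_sum {K : pzRingType} {V : lmodType K} (phi : V -> K) (I : finType)
    (c : I -> K) (x : I -> V) :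
  scalar phi -> phi (\sum_i c i *: x i) = \sum_i c i * phi (x i).
Proof.
move=> h; rewrite (big_morph phi (fun u v => scalar_formD u v h) (scalar_form0 h)).
by apply: eq_bigr => i _; exact: scalar_formZ.
Qed.

Section MatrixCoefficients.
Variables (R : realType) (n : nat).
Hypothesis hn : (1 < n)%N.
Local Notation C := R[i].
Local Notation w := (@eta_exp R n).

(** Together with [off_coef], the entries of the 2 x 2 corepresentation with rows ([diag_coef u v],
    [off_coef u (- v)]) and ([off_coef u v], [diag_coef u (- v)]). *)
Definition diag_coef (u v : 'Z_n) : KP R n := ([ffun p => w (p.1 * u + p.2 * v)], 0).
Definition off_coef (u v : 'Z_n) : KP R n :=
  (0, \matrix_(i, j) ((j == i + u)%:R * w (i * v))).

Lemma KP_fst_sum (I : finType) (F : I -> KP R n) : (\sum_i F i).1 = \sum_i (F i).1.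
Proof. exact: (raddf_sum (@fst {ffun 'Z_n * 'Z_n -> C} 'M[C]_((Zp_trunc n).+2))). Qed.

Lemma KP_snd_sum (I : finType) (F : I -> KP R n) : (\sum_i F i).2 = \sum_i (F i).2.
Proof. exact: (raddf_sum (@snd {ffun 'Z_n * 'Z_n -> C} 'M[C]_((Zp_trunc n).+2))). Qed.

Lemma KP_ext (x y : KP R n) :
  (forall b, KP_coord x b = KP_coord y b) -> x = y.
Proof.
case: x y => [x1 x2] [y1 y2] h; congr pair.
  by apply/ffunP => -[i j]; exact: (h (inl (i, j))).
by apply/matrixP => i j; exact: (h (inr (i, j))).
Qed.

Lemma coord_sum (I : finType) (F : I -> KP R n) b :
  KP_coord (\sum_i F i) b = \sum_i KP_coord (F i) b.
Proof.
case: b => -[i j] /=; first by rewrite KP_fst_sum sum_ffunE.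
by rewrite KP_snd_sum summxE.
Qed.

Lemma coordZ k (x : KP R n) b : KP_coord (k *: x) b = k * KP_coord x b.
Proof. by case: b => -[i j] /=; rewrite ?ffunE ?mxE. Qed.

Lemma coord_basis b b' : KP_coord (KP_basis R b) b' = (b == b' :> KP_idx n)%:R.
Proof.
case: b => -[i j]; case: b' => -[k l] /=; rewrite ?ffunE ?mxE //.
  by rewrite eq_sym.
by congr (_%:R); rewrite [in RHS]/eq_op /= xpair_eqE [k == _]eq_sym [l == _]eq_sym.
Qed.

Lemma KP_basis_sum (x : KP R n) : x = \sum_b KP_coord x b *: KP_basis R b.
Proof.
apply: KP_ext => b; rewrite coord_sum (bigD1 b) //= coordZ coord_basis eqxx mulr1.
by rewrite big1 ?addr0 // => b' /negPf hb; rewrite coordZ coord_basis hb mulr0.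
Qed.

Lemma diag_coefE u v :
  diag_coef u v = \sum_p w (p.1 * u + p.2 * v) *: unit_e R p.1 p.2.
Proof.
apply: KP_ext => b; rewrite coord_sum; case: b => -[i j] /=.
  rewrite ffunE (bigD1 (i, j)) //= !ffunE eqxx big1 ?addr0.
    by rewrite -[_ *: _]/(_ * _) mulr1.
  by move=> [i' j'] /negPf h; rewrite !ffunE eq_sym h; exact: mulr0.
by rewrite mxE big1 // => p _; rewrite scaler0 mxE.
Qed.

Lemma off_coefE u v : off_coef u v = \sum_m w (m * v) *: unit_E R m (m + u).
Proof.
apply: KP_ext => b; rewrite coord_sum; case: b => -[i j] /=.
  by rewrite ffunE big1 // => p _; rewrite scaler0 ffunE.
rewrite mxE (bigD1 i) //= !mxE eqxx /= big1 ?addr0 => [|k /negPf h]; first by rewrite mulrC.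
by rewrite !mxE eq_sym h mulr0.
Qed.

Section Conv.
Variables phi psi : KP R n -> C.

Lemma tens_form_scalar : scalar (tens_form phi psi).
Proof.
move=> k x y; rewrite /tens_form mulr_sumr -big_split; apply: eq_bigr => b _ /=.
by rewrite !ffunE -[k *: x b]/(k * x b) mulrDl !mulrA.
Qed.

Lemma Delta_linear : linear (@Delta R n).
Proof.
move=> k x y; rewrite /Delta scalerDr addrACA; congr (_ + _);
  rewrite scaler_sumr -big_split; apply: eq_bigr => i _ /=;
  rewrite scaler_sumr -big_split; apply: eq_bigr => j _ /=;
  by rewrite ?ffunE ?mxE scalerDl scalerA.
Qed.

Lemma convolution_scalar : scalar (convolution phi psi).
Proof.
by move=> k x y; rewrite /convolution Delta_linear tens_form_scalar.
Qed.

Hypotheses (hphi : scalar phi) (hpsi : scalar psi).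

Lemma tens_formE x y : tens_form phi psi (tens x y) = phi x * psi y.
Proof.
rewrite {2}[x]KP_basis_sum {2}[y]KP_basis_sum.
rewrite (scalar_form_sum _ _ hphi) (scalar_form_sum _ _ hpsi) mulr_suml.
under [RHS]eq_bigr do rewrite mulr_sumr.
rewrite pair_big /=; apply: eq_bigr => -[b c] _.
by rewrite ffunE /= mulrACA.
Qed.

Lemma form_Delta_e p : tens_form phi psi (Delta_e R p.1 p.2) =
  \sum_q phi (unit_e R q.1 q.2) * psi (unit_e R (p - q).1 (p - q).2)
  + n%:R^-1 * \sum_m \sum_r w (p.1 * (m - r)) *
     (phi (unit_E R m r) * psi (unit_E R (m + p.2) (r + p.2))).
Proof.
have tl := tens_form_scalar.
rewrite scalar_formD // scalar_formZ // !pair_big /=; congr (_ + _ * _); last first.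
  by rewrite scalar_form_sum //; apply: eq_bigr => q _; rewrite tens_formE.
under eq_bigr do rewrite -[tens _ _]scale1r.
by rewrite scalar_form_sum //; apply: eq_bigr => q _; rewrite tens_formE mul1r.
Qed.

Lemma form_Delta_E i j : tens_form phi psi (Delta_E R i j) =
  \sum_s \sum_t w (s * (i - j)) *
     (phi (unit_e R (- s) (- t)) * psi (unit_E R (i - t) (j - t)))
  + \sum_s \sum_t w (s * (j - i)) *
     (phi (unit_E R (i - t) (j - t)) * psi (unit_e R s t)).
Proof.
have tl := tens_form_scalar.
rewrite /Delta_E (scalar_formD _ _ tl).
by congr (_ + _); rewrite !pair_big (scalar_form_sum _ _ tl);
  apply: eq_bigr => q _; rewrite tens_formE.
Qed.

Lemma eta_expN x : w (- x) * w x = 1.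
Proof. by rewrite -eta_expD // addNr eta_exp0. Qed.

Lemma form_Delta (x : KP R n) : tens_form phi psi (Delta x) =
  \sum_p x.1 p * tens_form phi psi (Delta_e R p.1 p.2)
  + \sum_i \sum_j x.2 i j * tens_form phi psi (Delta_E R i j).
Proof.
have tl := tens_form_scalar.
rewrite scalar_formD // !pair_big /= !(scalar_form_sum _ _ tl); congr (_ + _).
by apply: eq_bigr => -[].
Qed.

(** The e (x) e part of the coproduct is that of the group Z_n x Z_n, on which [diag_coef u v] is a
    character. The E (x) E part yields the product of off-diagonal coefficients. *)
Lemma convolution_diag_coef u v : convolution phi psi (diag_coef u v) =
  phi (diag_coef u v) * psi (diag_coef u v)
  + phi (off_coef u (- v)) * psi (off_coef u v).
Proof.
rewrite /convolution form_Delta [X in _ + X]big1 ?addr0 => [|i _]; last first.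
  by rewrite big1 // => j _; rewrite mxE mul0r.
under eq_bigr do rewrite form_Delta_e ffunE mulrDr.
rewrite big_split /=; congr (_ + _).
  under eq_bigr do rewrite mulr_sumr.
  rewrite exchange_big /= !diag_coefE.
  rewrite !(scalar_form_sum _ _ hphi, scalar_form_sum _ _ hpsi) mulr_suml.
  apply: eq_bigr => q _.
  rewrite mulr_sumr (reindex_inj (addIr q)) /=; apply: eq_bigr => p _.
  rewrite addrK !mulrDl addrACA eta_expD //.
  rewrite addrK; ring.
transitivity (\sum_i \sum_j w (i * u + j * v) *
    (n%:R^-1 * (\sum_m \sum_r w (i * (m - r)) *
     (phi (unit_E R m r) * psi (unit_E R (m + j) (r + j)))))).
  by rewrite pair_big.
rewrite exchange_big /=.
(* Summing over i first gives a full character sum of Z/n, which leaves only r = m + u and cancels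
   the factor 1/n. *)
transitivity (\sum_(j : 'Z_n) \sum_(m : 'Z_n) w (j * v) *
    (phi (unit_E R m (m + u)) * psi (unit_E R (m + j) (m + u + j)))).
  apply: eq_bigr => j _.
  transitivity (\sum_m \sum_r (\sum_i w (i * (u + m - r))) / n%:R *
      (w (j * v) * (phi (unit_E R m r) * psi (unit_E R (m + j) (r + j))))).
    under eq_bigr do rewrite mulrA mulr_sumr.
    rewrite exchange_big; apply: eq_bigr => m _ /=.
    under eq_bigr do rewrite mulr_sumr.
    rewrite exchange_big; apply: eq_bigr => r _ /=.
    rewrite !mulr_suml; apply: eq_bigr => i _.
    rewrite -[u + m - r]addrA [i * (u + _)]mulrDr !eta_expD //; ring.
  apply: eq_bigr => m _; rewrite (bigD1 (m + u)) //= sum_eta_exp // [u + m]addrC subrr eqxx.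
  rewrite mul1r divff ?natCn0 // mul1r big1 ?addr0 // => r hr.
  by rewrite sum_eta_exp // subr_eq0 eq_sym (negPf hr) !mul0r.
rewrite !off_coefE !(scalar_form_sum _ _ hphi, scalar_form_sum _ _ hpsi).
rewrite mulr_suml exchange_big; apply: eq_bigr => m _ /=.
(* Replacing j by j - m moves the second matrix unit to row j; the phase splits as w (j v) w (- m
   v), hence the index - v in the first factor. *)
rewrite mulr_sumr (reindex_inj (addIr (- m))) /=; apply: eq_bigr => j _.
rewrite [m + u + _]addrAC [m + (j - m)]addrCA subrr addr0.
rewrite mulrBl eta_expD // mulrN. ring.
Qed.

Lemma convolution_off_coef u v : convolution phi psi (off_coef u v) =
  phi (diag_coef u (- v)) * psi (off_coef u v)
  + phi (off_coef u v) * psi (diag_coef u v).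
Proof.
rewrite /convolution form_Delta big1 ?add0r => [|p _]; last by rewrite ffunE mul0r.
(* Row m of [off_coef u v] has its only nonzero entry in column m + u. *)
under eq_bigr => m _.
  rewrite (bigD1 (m + u)) //= big1 ?addr0 => [|j /negPf h]; last first.
    by rewrite mxE h !mul0r.
  rewrite mxE eqxx mul1r form_Delta_E mulrDr; over.
rewrite big_split /=; congr (_ + _).
  transitivity (\sum_p \sum_m w (m * v) * (w (- (p.1 * u)) *
      (phi (unit_e R (- p.1) (- p.2)) *
       psi (unit_E R (m - p.2) (m - p.2 + u))))).
    rewrite exchange_big; apply: eq_bigr => m _; rewrite pair_big mulr_sumr.
    apply: eq_bigr => p _ /=; rewrite opprD addNKr mulrN.
    by rewrite [m + u - _]addrAC.
  rewrite diag_coefE off_coefE.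
  rewrite !(scalar_form_sum _ _ hphi, scalar_form_sum _ _ hpsi) mulr_suml.
  (* The sign change absorbs the indices (-s, -t) of the coproduct; the shift of m that follows
     produces the phase w (- t v), hence [diag_coef u (- v)]. *)
  rewrite (reindex_inj (@oppr_inj ('Z_n * 'Z_n)%type)) /=.
  apply: eq_bigr => p _; rewrite mulr_sumr [LHS](reindex_inj (addIr (- p.2))) /=.
  apply: eq_bigr => m _; rewrite !opprK subrK mulrBl !eta_expD // mulNr opprK mulrN; ring.
transitivity (\sum_p \sum_m w (m * v) * (w (p.1 * u) *
    (phi (unit_E R (m - p.2) (m - p.2 + u)) * psi (unit_e R p.1 p.2)))).
  rewrite exchange_big; apply: eq_bigr => m _; rewrite pair_big mulr_sumr.
  apply: eq_bigr => p _ /=; rewrite [m + u - m]addrAC subrr add0r.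
  by rewrite [m + u - _]addrAC.
rewrite diag_coefE off_coefE.
rewrite !(scalar_form_sum _ _ hphi, scalar_form_sum _ _ hpsi) mulr_sumr.
apply: eq_bigr => p _; rewrite mulr_suml [LHS](reindex_inj (addIr p.2)) /=.
apply: eq_bigr => m _; rewrite addrK mulrDl !eta_expD //; ring.
Qed.
End Conv.
End MatrixCoefficients.

(** * Haar state and characters *)

Section HaarState.
Variables (R : realType) (n : nat).
Hypothesis hn : (1 < n)%N.
Local Notation C := R[i].
Local Notation w := (@eta_exp R n).

(** A common form for all characters: [Rho] and [Sigma] have y = 1 or -1 with v = 0 or n/2, and
    [Xuv] is a sum of two such elements with y = 0. *)
Definition coef_comb (y : C) (u v : 'Z_n) : KP R n :=
  diag_coef R u v + y *: off_coef R u v.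

Lemma haar_mulE (x y : KP R n) : haar (x * y) = (2 * n%:R ^+ 2)^-1 *
  (\sum_p x.1 p * y.1 p + n%:R * \sum_i \sum_j x.2 i j * y.2 j i).
Proof.
rewrite /haar pair_big /=; congr (_ * (_ + _ * _)).
  by apply: eq_bigr => -[i j] _ /=; rewrite ffunE.
by apply: eq_bigr => i _; rewrite mxE.
Qed.

Lemma haar_scalar : scalar (@haar R n).
Proof.
move=> k x y; rewrite /haar [k * (_ * _)]mulrCA -mulrDr; congr (_ * _).
rewrite mulrDr addrACA [k * (n%:R * _)]mulrCA -mulrDr; congr (_ + _ * _).
  rewrite mulr_sumr -big_split; apply: eq_bigr => i _ /=.
  by rewrite mulr_sumr -big_split; apply: eq_bigr => j _ /=; rewrite !ffunE.
by rewrite mulr_sumr -big_split; apply: eq_bigr => i _ /=; rewrite !mxE.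
Qed.

(** Since [fourier a] has a as right factor, this is the linearity that expands it along the
    characters. *)
Lemma haar_mull_scalar (x : KP R n) : scalar (fun y => haar (x * y)).
Proof.
move=> k y z; rewrite mulrDr scalar_formD; last exact: haar_scalar.
congr (_ + _); rewrite !haar_mulE [k * (_ * _)]mulrCA; congr (_ * _).
rewrite mulrDr [k * (n%:R * _)]mulrCA; congr (_ + _ * _).
  by rewrite mulr_sumr; apply: eq_bigr => p _; rewrite ffunE; exact: mulrCA.
rewrite mulr_sumr; apply: eq_bigr => i _; rewrite mulr_sumr.
by apply: eq_bigr => j _; rewrite mxE mulrCA.
Qed.

Lemma coef_comb1 y u v p : (coef_comb y u v).1 p = w (p.1 * u + p.2 * v).
Proof. by rewrite /= scaler0 addr0 ffunE. Qed.

Lemma coef_comb2 y u v i j : (coef_comb y u v).2 i j = (j == i + u)%:R * (y * w (i * v)).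
Proof. by rewrite /= add0r !mxE mulrCA. Qed.

(** Both the commutative part and the trace part are sums of characters of Z_n, which vanish unless
    (u', v') = (-u, -v). The trace part picks up w (u v') because its second factor is read in row i
    + u. *)
Lemma haar_coef_comb_mul y z u v u' v' : haar (coef_comb y u v * coef_comb z u' v') =
  ((u' == - u) && (v' == - v))%:R * (1 + y * z * w (u * v')) / 2.
Proof.
rewrite haar_mulE.
have -> : \sum_p (coef_comb y u v).1 p * (coef_comb z u' v').1 p =
    ((u' == - u) && (v' == - v))%:R * n%:R ^+ 2.
  transitivity (\sum_i \sum_j w (i * (u + u')) * w (j * (v + v'))).
    rewrite pair_big; apply: eq_bigr => p _ /=.
    apply: etrans (f_equal2 *%R (coef_comb1 y u v p) (coef_comb1 z u' v' p)) _.
    rewrite !mulrDr !(eta_expD R hn); ring.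
  under eq_bigr do rewrite -mulr_sumr sum_eta_exp //.
  rewrite -mulr_suml sum_eta_exp // addrC addr_eq0 [v + _]addrC addr_eq0.
  by rewrite -mulnb natrM; ring.
have -> : \sum_i \sum_j (coef_comb y u v).2 i j * (coef_comb z u' v').2 j i =
    ((u' == - u) && (v' == - v))%:R * (y * z * w (u * v')) * n%:R.
  transitivity (\sum_i (u' == - u)%:R * (y * z * w (u * v')) * w (i * (v + v'))).
    apply: eq_bigr => i _; rewrite (bigD1 (i + u)) // big1 ?[LHS]addr0 => [|j /negPf h].
      apply: etrans (f_equal2 *%R (coef_comb2 y u v _ _) (coef_comb2 z u' v' _ _)) _.
      rewrite eqxx mul1r -addrA -[X in X == _]addr0 (inj_eq (addrI i)) eq_sym.
      rewrite [u + _]addrC addr_eq0 mulrDl mulrDr !eta_expD //; ring.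
    apply: etrans (f_equal2 *%R (coef_comb2 y u v i j) erefl) _.
    by rewrite h !mul0r.
  rewrite -mulr_sumr sum_eta_exp // [v + _]addrC addr_eq0 -mulnb natrM; ring.
field; rewrite natCn0 //.
Qed.

Lemma coef_comb_unit : coef_comb 1 0 0 = 1.
Proof.
apply: KP_ext => -[] [i j].
  by rewrite [LHS]coef_comb1 /= !mulr0 addr0 eta_exp0 // ffunE.
by rewrite [LHS]coef_comb2 addr0 mulr0 eta_exp0 // !mulr1 /= mxE eq_sym.
Qed.

Lemma haar_coef_comb y u v :
  haar (coef_comb y u v) = ((u == 0) && (v == 0))%:R * (1 + y) / 2.
Proof.
rewrite -[coef_comb y u v]mul1r -coef_comb_unit haar_coef_comb_mul.
by rewrite oppr0 mul0r eta_exp0 // mul1r mulr1.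
Qed.

(** For even n, the unique element of order two in Z_n. *)
Definition half_Zp : 'Z_n := (n./2)%:R.
Local Notation Zhalf := half_Zp.

(** The value differs from 1 because 0 < n/2 < n, and its square is eta^n = 1. *)
Lemma eta_half : ~~ odd n -> w Zhalf = -1.
Proof.
move=> ev; have : w Zhalf != 1.
  apply: eta_exp_neq1 => //; rewrite /half_Zp; apply/eqP => /(congr1 (@nat_of_ord _)).
  by rewrite val_Zp_nat // modn_small /=; lia.
have : (w Zhalf - 1) * (w Zhalf + 1) = 0.
  rewrite -subr_sqr expr1n expr2 -eta_expD // /half_Zp -natrD addnn.
  have -> : (n./2).*2 = n by lia.
  by rewrite eta_expE // eta_n // subrr.
by move/eqP; rewrite mulf_eq0 subr_eq0 addr_eq0 => /orP[->//|/eqP].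
Qed.

Lemma eta_halfX (j : 'Z_n) : ~~ odd n -> w (j * Zhalf) = (-1) ^+ (j : nat).
Proof.
move=> ev; rewrite -{1}[j]natr_Zp -natrM mulnC eta_expE // exprM.
by rewrite -(eta_expE R hn) -/half_Zp eta_half.
Qed.

Lemma half_ZpD : ~~ odd n -> Zhalf + Zhalf = 0.
Proof.
move=> ev; rewrite /half_Zp -natrD addnn; have -> : (n./2).*2 = n by lia.
by apply: ord_inj; rewrite val_Zp_nat // modnn.
Qed.

Lemma eta_exp_neq0 x : w x != 0.
Proof.
apply/eqP => h; have := eta_expN R hn x.
by rewrite h mulr0 => /esym/eqP; rewrite oner_eq0.
Qed.

Lemma eta_expV x : w (- x) = (w x)^-1.
Proof. by apply: (mulIf (eta_exp_neq0 x)); rewrite eta_expN // mulVf ?eta_exp_neq0. Qed.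

Lemma eta_powD_inv (k : nat) : eta R n ^+ k + (eta R n ^+ k)^-1 =
  2 * Complex (cos (2 * pi / n%:R * k%:R)) 0.
Proof.
have -> : (eta R n ^+ k)^-1 =
    Complex (cos (2 * pi / n%:R * k%:R)) (- sin (2 * pi / n%:R * k%:R)).
  have ek0 : eta R n ^+ k != 0 by rewrite -eta_expE ?eta_exp_neq0.
  apply: (mulfI ek0); rewrite divff //.
  rewrite eta_pow //; set t := _ * k%:R; have := cos2Dsin2 t => h.
  by apply/eqP; rewrite eq_complex /=; apply/andP; split; apply/eqP; [rewrite -h|]; ring.
rewrite eta_pow //; set t := _ * k%:R.
by apply/eqP; rewrite eq_complex /=; apply/andP; split; apply/eqP; ring.
Qed.

Lemma chi_rho s l : irr_char (Rho s l) = coef_comb ((-1) ^+ s) l 0 :> KP R n.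
Proof.
rewrite /= /coef_comb diag_coefE off_coefE pair_big /=; congr (_ + _ *: _).
  by apply: eq_bigr => p _; rewrite mulr0 addr0.
by apply: eq_bigr => m _; rewrite mulr0 eta_exp0 // scale1r.
Qed.

Lemma chi_sigma h s l : irr_char (Sigma h s l) = coef_comb ((-1) ^+ s) l Zhalf :> KP R n.
Proof.
rewrite /= /coef_comb diag_coefE off_coefE pair_big /=; congr (_ + _ *: _).
  by apply: eq_bigr => p _; rewrite eta_expD // eta_halfX // mulrC.
by apply: eq_bigr => m _; rewrite eta_halfX.
Qed.

Lemma chi_X u (v : 'I_n) (h : (1 <= v <= (n.-1)./2)%N) :
  irr_char (Xuv u h) =
  coef_comb 0 u (v : nat)%:R + coef_comb 0 u (- (v : nat)%:R) :> KP R n.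
Proof.
rewrite /= /coef_comb !scale0r !addr0 !diag_coefE pair_big scaler_sumr -big_split.
apply: eq_bigr => -[s t] _ /=.
rewrite -scalerDl [LHS]scalerA; congr (_ *: _).
rewrite mulrN !(eta_expD R hn) -mulrDr mulrCA; congr (_ * _).
rewrite -{2 3}[t]natr_Zp -(natrM 'Z_n).
rewrite eta_expV eta_expE // eta_powD_inv; congr (_ * Complex (cos _) _).
by rewrite natrM; ring.
Qed.

End HaarState.

(** * Orthogonality *)

Section Orthogonality.
Variables (R : realType) (n : nat).
Hypothesis hn : (1 < n)%N.
Local Notation C := R[i].
Local Notation w := (@eta_exp R n).
Local Notation Zhalf := (half_Zp n).

Lemma half_Zp_neq0 : ~~ odd n -> Zhalf != 0.
Proof.
move=> ev; apply/eqP => h; have := eta_half R hn ev.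
rewrite h eta_exp0 // => /eqP; rewrite -subr_eq0 opprK -mulr2n.
by rewrite pnatr_eq0.
Qed.

(** As integers, 0 < k + k' <= n - 1. This separates the second indices of the [Xuv] from 0, from
    n/2 and from the opposites of one another. *)
Lemma natZp_add_neq0 (k k' : 'I_n) : (1 <= k <= (n.-1)./2)%N ->
  (1 <= k' <= (n.-1)./2)%N -> k%:R + k'%:R != 0 :> 'Z_n.
Proof.
move=> hk hk'; rewrite -natrD; apply/eqP => /(congr1 (@nat_of_ord _)).
by rewrite val_Zp_nat // modn_small /=; lia.
Qed.

Lemma natZp_eq (k k' : 'I_n) : (k%:R == k'%:R :> 'Z_n) = (k == k').
Proof.
apply/eqP/eqP => [/(congr1 (@nat_of_ord _))|->//].
by rewrite !val_Zp_nat // !modn_small // => /val_inj.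
Qed.

(** A family biorthogonal to the characters for the pairing haar (x y), up to the factor 1/d. For
    [Sigma], the sign w (l n/2) cancels the phase that this pairing introduces. *)
Definition dual_coef (al : KP_irr n) : KP R n :=
  match al with
  | Rho s l => coef_comb ((-1) ^+ s) (- l) 0
  | Xuv u v _ => coef_comb 0 (- u) (v : nat)%:R
  | Sigma _ s l => coef_comb ((-1) ^+ s * w (l * Zhalf)) (- l) Zhalf
  end.

Lemma sign_orth (s s' : bool) :
  (1 + (-1) ^+ s * (-1) ^+ s') / 2 = (s == s')%:R :> C.
Proof. by case: s; case: s' => /=; rewrite ?expr0 ?expr1; field. Qed.

Lemma haar_coef_comb_rho (y : C) u v s l :
  @haar R n (coef_comb y u v * irr_char (Rho s l)) =
  ((l == - u) && (v == 0))%:R * ((1 + y * (-1) ^+ s) / 2).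
Proof.
rewrite (chi_rho _ hn) (haar_coef_comb_mul hn) mulr0 (eta_exp0 _ hn) mulr1.
by rewrite [0 == _]eq_sym oppr_eq0 mulrA.
Qed.

Lemma half_ZpN : ~~ odd n -> - Zhalf = Zhalf.
Proof. by move=> ev; apply/eqP; rewrite eq_sym -addr_eq0 (half_ZpD hn). Qed.

Lemma haar_coef_comb_sigma (y : C) u v ev s l :
  @haar R n (coef_comb y u v * irr_char (Sigma ev s l)) =
  ((l == - u) && (v == Zhalf))%:R * ((1 + y * (-1) ^+ s * w (u * Zhalf)) / 2).
Proof.
rewrite (chi_sigma _ hn) (haar_coef_comb_mul hn) -mulrA; congr ((_ && _)%:R * _).
by rewrite -{1}(half_ZpN ev) eqr_opp eq_sym.
Qed.

Lemma haar_coef_comb_X (y : C) u v l (k : 'I_n) (h : (1 <= k <= (n.-1)./2)%N) :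
  @haar R n (coef_comb y u v * irr_char (Xuv l h)) =
  (l == - u)%:R * ((v == - k%:R)%:R + (v == k%:R)%:R) / 2.
Proof.
rewrite (chi_X _ hn) mulrDr (scalar_formD _ _ (@haar_scalar R n)).
apply: etrans (f_equal2 +%R (haar_coef_comb_mul hn _ _ _ _ _ _)
  (haar_coef_comb_mul hn _ _ _ _ _ _)) _.
rewrite !mulr0 !mul0r addr0 !mulr1 -!mulnb !natrM eqr_opp [k%:R == v]eq_sym.
by rewrite -[k%:R == - v]eqr_oppLR [- k%:R == v]eq_sym -mulrDl -mulrDr.
Qed.

(** Distinct families are orthogonal because 0, n/2 and the v, - v of [Xuv] are different second
    indices. The factor 1/2 for [Xuv] is the Haar pairing of its dual element with the one summand
    of the character that it meets. *)
Lemma haar_dual_irr_char al be :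
  @haar R n (dual_coef al * irr_char be) = (al == be)%:R / (irr_dim al)%:R.
Proof.
(* On codes, equality of irreducibles reduces by cases to equality of signs and indices. *)
rewrite -(can_eq (@encode_irrK n)).
have X0 (k : 'I_n) : (1 <= k <= (n.-1)./2)%N -> k%:R != 0 :> 'Z_n.
  by move=> hk; apply: contraNneq (natZp_add_neq0 hk hk) => ->; rewrite addr0.
have Xh (k : 'I_n) : ~~ odd n -> (1 <= k <= (n.-1)./2)%N -> k%:R != Zhalf.
  by move=> ev hk; apply: contraNneq (natZp_add_neq0 hk hk) => ->; rewrite (half_ZpD hn).
case: al => [s l|u v hv|ev s l]; case: be => [s' l'|u' v' hv'|ev' s' l'];
  rewrite /dual_coef ?haar_coef_comb_rho ?haar_coef_comb_X ?haar_coef_comb_sigma ?opprK.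
- rewrite eqxx andbT sign_orth invr1 mulr1 -natrM mulnb.
  by rewrite andbC [l' == l]eq_sym.
- rewrite ![0 == _ :> 'Z_n]eq_sym oppr_eq0 (negPf (X0 _ hv')) addr0 mulr0 mul0r.
  by rewrite mul0r.
- by rewrite [0 == _ :> 'Z_n]eq_sym (negPf (half_Zp_neq0 ev')) andbF !mul0r.
- by rewrite (negPf (X0 _ hv)) andbF !mul0r.
- rewrite -addr_eq0 (negPf (natZp_add_neq0 hv hv')) natZp_eq add0r -natrM mulnb.
  by rewrite [u' == u]eq_sym.
- by rewrite (negPf (Xh _ ev' hv)) andbF !mul0r.
- by rewrite (negPf (half_Zp_neq0 ev)) andbF !mul0r.
- rewrite -[Zhalf == - _]eqr_oppLR half_ZpN // [Zhalf == _]eq_sym (negPf (Xh _ ev hv')).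
  by rewrite addr0 mulr0 !mul0r.
- rewrite eqxx andbT mulNr (eta_expV _ hn) [_ * w _ * _]mulrAC -[_ * w _ * _]mulrA.
  rewrite divff ?eta_exp_neq0 // mulr1 sign_orth invr1 mulr1 -natrM mulnb.
  by rewrite andbC [l' == l]eq_sym.
Qed.

(** When 2v is nonzero only the [Xuv] characters can contribute; they have no matrix part, so y is
    irrelevant, and they are symmetric under v -> - v. This is the form in which centrality of a is
    used. *)
Lemma haar_coef_comb_irr_charN (y : C) u v be : v + v != 0 ->
  @haar R n (coef_comb y u v * irr_char be) =
  @haar R n (coef_comb 0 u (- v) * irr_char be).
Proof.
move=> v2.
have v0 : v != 0 by apply: contraNneq v2 => ->; rewrite addr0.
have vh : ~~ odd n -> v != Zhalf.
  by move=> ev; apply: contraNneq v2 => ->; rewrite (half_ZpD hn).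
case: be => [s' l'|u' v' hv'|ev' s' l'].
- apply: etrans (haar_coef_comb_rho _ _ _ _ _) _.
  apply: (etrans _ (esym (haar_coef_comb_rho _ _ _ _ _))).
  by rewrite oppr_eq0 (negPf v0) andbF !mul0r.
- apply: etrans (haar_coef_comb_X _ _ _ _ _) _.
  apply: (etrans _ (esym (haar_coef_comb_X _ _ _ _ _))).
  by rewrite eqr_opp eqr_oppLR addrC.
- apply: etrans (haar_coef_comb_sigma _ _ _ _ _ _) _.
  apply: (etrans _ (esym (haar_coef_comb_sigma _ _ _ _ _ _))).
  by rewrite eqr_oppLR half_ZpN // (negPf (vh ev')) andbF !mul0r.
Qed.

(** The three cases correspond to the families [Rho], [Sigma] and [Xuv]. *)
Lemma Zp_cases (v : 'Z_n) :
  [\/ v = 0, (~~ odd n /\ v = Zhalf) |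
   exists k : 'I_n, (1 <= k <= (n.-1)./2)%N /\ (v = k%:R \/ v = - k%:R)].
Proof.
have vn : (v < n)%N by have := ltn_ord v; rewrite {2}Zp_cast.
have [v0|v0] := eqVneq (v : nat) 0%N; first by constructor 1; apply: val_inj.
have [vh|vh] := eqVneq (v : nat).*2 n.
  constructor 2; split; first lia.
  by rewrite -[v]natr_Zp /half_Zp; congr _%:R; lia.
have [vs|vs] := leqP (v : nat) (n.-1)./2.
  constructor 3; exists (Ordinal vn); split; first by rewrite /= lt0n v0.
  by left; rewrite /= natr_Zp.
have vn' : (n - v < n)%N by lia.
constructor 3; exists (Ordinal vn'); split; first by rewrite /=; lia.
right; apply/eqP; rewrite -addr_eq0 -{1}[v]natr_Zp -natrD /=; apply/eqP.
by apply: ord_inj; rewrite val_Zp_nat // subnKC ?modnn // ltnW.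
Qed.

(** * Convolution powers of a functional on the coefficients *)

Section Walk.
Variables (phi : KP R n -> C).
Hypothesis hphi : scalar phi.

(** The first power is phi itself rather than a convolution with the counit, so the recursion starts
    at exponent 2 and the inductions below treat 0 and 1 separately. *)
Lemma conv_powS k : conv_pow phi k.+2 = convolution phi (conv_pow phi k.+1).
Proof. by []. Qed.

Lemma conv_pow_scalar k : scalar (conv_pow phi k).
Proof.
case: k => [|[|k]] //; last by rewrite conv_powS; exact: convolution_scalar.
by move=> z x y; rewrite /conv_pow /= /counit /= !ffunE.
Qed.

Lemma scalar_form_coef_comb (psi : KP R n -> C) y u v : scalar psi ->
  psi (coef_comb y u v) = psi (diag_coef R u v) + y * psi (off_coef R u v).
Proof. by move=> h; rewrite /coef_comb (scalar_formD _ _ h) (scalar_formZ _ _ h). Qed.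

Lemma conv_pow_coef_comb k (y : C) u v : v + v = 0 -> y ^+ 2 = 1 ->
  conv_pow phi k (coef_comb y u v) = phi (coef_comb y u v) ^+ k.
Proof.
move=> v2 y2; have vN : - v = v by apply/eqP; rewrite eq_sym -addr_eq0 v2.
elim: k => [|k IH].
  by rewrite expr0 /conv_pow /= /counit coef_comb1 /= !mul0r addr0 eta_exp0.
case: k IH => [|k] IH; first by rewrite expr1.
rewrite exprS -IH conv_powS; have hk := conv_pow_scalar k.+1.
rewrite [LHS]scalar_form_coef_comb; last exact: convolution_scalar.
rewrite convolution_diag_coef // convolution_off_coef // vN !scalar_form_coef_comb //.
set a := phi _; set b := phi _; set c := conv_pow _ _ _; set d := conv_pow _ _ _.
(* Since - v = v, both convolution formulas involve the same four values, and y^2 = 1 makes their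
   combination factor. *)
have -> : (a + y * b) * (c + y * d) =
    a * c + y ^+ 2 * (b * d) + y * (a * d + b * c) by ring.
by rewrite y2 mul1r.
Qed.

(** Each term of the convolution formula contains an off-diagonal value, either of phi or of the
    preceding power. *)
Lemma conv_pow_off_coef k u v :
  (forall v, v + v != 0 -> phi (off_coef R u v) = 0) ->
  v + v != 0 -> conv_pow phi k (off_coef R u v) = 0.
Proof.
move=> h v2; elim: k => [|k IH]; first by rewrite /conv_pow /= /counit ffunE.
case: k IH => [|k] IH; first exact: h.
rewrite conv_powS convolution_off_coef ?IH ?h ?mulr0 ?mul0r ?addr0 //.
exact: conv_pow_scalar.
Qed.

Lemma conv_pow_diag_coef k u v :
  (forall v, v + v != 0 -> phi (off_coef R u v) = 0) ->
  v + v != 0 -> conv_pow phi k (diag_coef R u v) = phi (diag_coef R u v) ^+ k.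
Proof.
move=> h v2; elim: k => [|k IH].
  by rewrite expr0 /conv_pow /= /counit ffunE /= !mul0r addr0 eta_exp0.
case: k IH => [|k] IH; first by rewrite expr1.
rewrite conv_powS convolution_diag_coef //; last exact: conv_pow_scalar.
by rewrite (conv_pow_off_coef _ h v2) mulr0 addr0 IH -exprS.
Qed.
End Walk.
End Orthogonality.

(** * The random walk *)

Section RandomWalk.
Variables (R : realType) (n : nat).
Hypothesis hn : (1 < n)%N.
Local Notation C := R[i].
Local Notation w := (@eta_exp R n).
Local Notation Zhalf := (half_Zp n).

(** Fourier inversion on Z_n x Z_n. *)
Lemma unit_e_span (i j : 'Z_n) : unit_e R i j =
  \sum_p ((n%:R ^+ 2)^-1 * w (- (p.1 * i + p.2 * j))) *: diag_coef R p.1 p.2.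
Proof.
apply: KP_ext => b; rewrite coord_sum; under eq_bigr do rewrite coordZ.
case: b => -[k l] /=; last first.
  by rewrite mxE big1 // => p _; rewrite mulr0.
rewrite ffunE; apply/esym.
transitivity ((n%:R ^+ 2)^-1 *
    \sum_(p1 : 'Z_n) \sum_(p2 : 'Z_n) w (p1 * (k - i)) * w (p2 * (l - j))).
  rewrite pair_big mulr_sumr; apply: eq_bigr => p _ /=.
  rewrite ffunE /= -mulrA -!eta_expD //; congr (_ * w _).
  rewrite !mulrBr opprD [k * _]mulrC [l * _]mulrC [RHS]addrACA addrC.
  by rewrite [- (p.1 * i) - _]addrC [_ - p.1 * i]addrC.
under eq_bigr do rewrite -mulr_sumr sum_eta_exp //.
rewrite -mulr_suml sum_eta_exp // !subr_eq0 xpair_eqE -mulnb natrM.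
have := @natCn0 R n hn; set N := n%:R; move=> N0; field.
by [].
Qed.

(** Fourier inversion on Z_n along the cyclic diagonal of entries (m, m + j - i). *)
Lemma unit_E_span (i j : 'Z_n) : unit_E R i j =
  \sum_(v : 'Z_n) (n%:R^-1 * w (- (i * v))) *: off_coef R (j - i) v.
Proof.
apply: KP_ext => b; rewrite coord_sum; under eq_bigr do rewrite coordZ.
case: b => -[k l] /=.
  by rewrite ffunE big1 // => p _; rewrite mulr0.
rewrite mxE; apply/esym.
transitivity (n%:R^-1 * (l == k + (j - i))%:R * \sum_(v : 'Z_n) w (v * (k - i))).
  rewrite mulr_sumr; apply: eq_bigr => v _.
  rewrite mxE mulrBr eta_expD // [v * k]mulrC [v * i]mulrC; ring.
rewrite sum_eta_exp // subr_eq0.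
have [->|_] := eqVneq k i; last by rewrite mul0r mulr0.
by rewrite addrC subrK mul1r mulrAC mulVf ?mul1r ?natCn0.
Qed.

Lemma haar_coef_eq0 u v : v + v != 0 ->
  @haar R n (diag_coef R u v) = 0 /\ @haar R n (off_coef R u v) = 0.
Proof.
move=> v2; have /negPf v0 : v != 0 by apply: contraNneq v2 => ->; rewrite addr0.
(* As this holds for every y, the values y = 0 and y = 1 separate the two integrals. *)
have e y : @haar R n (diag_coef R u v) + y * @haar R n (off_coef R u v) = 0.
  rewrite -(scalar_form_coef_comb y u v (@haar_scalar R n)).
  by rewrite (haar_coef_comb hn) v0 andbF !mul0r.
have hA : @haar R n (diag_coef R u v) = 0 by have := e 0; rewrite mul0r addr0.
by split=> //; have := e 1; rewrite hA mul1r add0r.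
Qed.

(** * The walk driven by a combination of characters *)

Section Walk.
Variables (a : KP R n) (c : KP_irr n -> C).
Hypotheses (ha : a = \sum_al c al *: irr_char al) (hstate : is_state (fourier a)).
Local Notation phi := (fourier a).

Lemma fourier_scalar : scalar phi.
Proof. by case: hstate. Qed.

Lemma fourier_dual_coef al : phi (dual_coef R al) = c al / (irr_dim al)%:R.
Proof.
rewrite /fourier ha (scalar_form_sum _ _ (haar_mull_scalar (dual_coef R al))).
rewrite (bigD1 al) // big1 => [|be hb].
  by rewrite [LHS]addr0 (haar_dual_irr_char R hn) eqxx mul1r.
by rewrite (haar_dual_irr_char R hn) eq_sym (negPf hb) mul0r mulr0.
Qed.

Lemma fourier_coef_combN y u v :
  v + v != 0 -> phi (coef_comb y u v) = phi (coef_comb 0 u (- v)).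
Proof.
move=> v2; rewrite /fourier ha.
apply: etrans (scalar_form_sum _ _ (haar_mull_scalar (coef_comb y u v))) _.
apply: etrans _ (esym (scalar_form_sum _ _ (haar_mull_scalar (coef_comb 0 u (- v))))).
apply: eq_bigr => be _; apply: (f_equal ( *%R (c be))).
exact: haar_coef_comb_irr_charN.
Qed.

Lemma coef_comb0 (u v : 'Z_n) : coef_comb 0 u v = diag_coef R u v :> KP R n.
Proof. by rewrite /coef_comb scale0r addr0. Qed.

Lemma fourier_off_coef u v : v + v != 0 -> phi (off_coef R u v) = 0.
Proof.
move=> v2.
(* The value of phi at [coef_comb y u v] does not depend on y; comparing y = 1 with y = 0 isolates
   the off-diagonal term. *)
have e := etrans (fourier_coef_combN 1 u v2) (esym (fourier_coef_combN 0 u v2)).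
have e1 := scalar_form_coef_comb 1 u v fourier_scalar.
have e0 := scalar_form_coef_comb 0 u v fourier_scalar.
have := etrans (esym e1) (etrans e e0); rewrite mul0r mul1r.
by move/addrI.
Qed.

Lemma fourier_diag_coef_opp u v :
  v + v != 0 -> phi (diag_coef R u (- v)) = phi (diag_coef R u v).
Proof.
move=> v2; have e := fourier_coef_combN 0 u v2.
have e1 := congr1 phi (coef_comb0 u v).
have e2 := congr1 phi (coef_comb0 u (- v)).
exact (etrans (esym e2) (etrans (esym e) e1)).
Qed.

Lemma conv_pow_dual_coef al k :
  conv_pow phi k (dual_coef R al) = (c al / (irr_dim al)%:R) ^+ k.
Proof.
rewrite -fourier_dual_coef; case: al => [s l|u v hv|ev s l]; rewrite /dual_coef.
- by rewrite (conv_pow_coef_comb hn fourier_scalar) ?addr0 // sqrr_sign.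
- rewrite coef_comb0 (conv_pow_diag_coef hn fourier_scalar) //; first exact: fourier_off_coef.
  exact: (natZp_add_neq0 hn).
- rewrite (conv_pow_coef_comb hn fourier_scalar) ?(half_ZpD hn) // exprMn sqrr_sign mul1r.
  (* The coefficient w (l n/2) squares to w (0) = 1, so the element is group-like. *)
  by rewrite expr2 -(eta_expD R hn) -mulrDr (half_ZpD hn) // mulr0 eta_exp0.
Qed.

Lemma haar_dual_coef al : @haar R n (dual_coef R al) = (al == irr_unit)%:R.
Proof.
have chi1 : irr_char irr_unit = 1 :> KP R n.
  by rewrite /irr_unit (chi_rho R hn) expr0 coef_comb_unit.
have := haar_dual_irr_char R hn al irr_unit; rewrite chi1 mulr1 => ->.
have [->|_] := eqVneq al irr_unit; last by rewrite mul0r.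
by rewrite divr1.
Qed.

Lemma coef_unit : c irr_unit = 1.
Proof.
have [_ _ <-] := hstate; rewrite -(coef_comb_unit R hn).
have -> : coef_comb 1 0 0 = dual_coef R (@irr_unit n).
  by rewrite /irr_unit /dual_coef expr0 oppr0.
by rewrite fourier_dual_coef divr1.
Qed.

(** * The subspace of elements on which the walk converges *)

Let cvg_haar x :=
  ((fun k => conv_pow phi k x : C^o) @ \oo --> (haar x : C^o))%classic.

Lemma cvg_haarD x y : cvg_haar x -> cvg_haar y -> cvg_haar (x + y).
Proof.
move=> hx hy; rewrite /cvg_haar (scalar_formD _ _ (@haar_scalar R n)).
rewrite (_ : (fun k => _) = (fun k => conv_pow phi k x + conv_pow phi k y)).
  exact: cvgD hx hy.
by apply/funext => k; rewrite (scalar_formD _ _ (conv_pow_scalar fourier_scalar k)).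
Qed.

Lemma cvg_haarZ d x : cvg_haar x -> cvg_haar (d *: x).
Proof.
move=> hx; rewrite /cvg_haar (scalar_formZ _ _ (@haar_scalar R n)).
rewrite (_ : (fun k => _) = (fun k => d * conv_pow phi k x)).
  exact: (@cvgZl_tmp _ C^o _ _ _ d _ _ hx).
by apply/funext => k; rewrite (scalar_formZ _ _ (conv_pow_scalar fourier_scalar k)).
Qed.

Lemma cvg_haar_sum (I : finType) (d : I -> C) (x : I -> KP R n) :
  (forall i, cvg_haar (x i)) -> cvg_haar (\sum_i d i *: x i).
Proof.
move=> h; apply: (big_ind cvg_haar); [|exact: cvg_haarD|by move=> i _; exact: cvg_haarZ].
rewrite /cvg_haar (scalar_form0 (@haar_scalar R n)).
rewrite (_ : (fun k => _) = (fun=> 0)); first exact: cvg_cst.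
by apply/funext => k; rewrite (scalar_form0 (conv_pow_scalar fourier_scalar k)).
Qed.

(** Convergence at x is a linear condition, and by Fourier inversion the coefficients span the
    algebra. *)
Lemma cvg_haar_all : (forall u v, cvg_haar (diag_coef R u v)) ->
  (forall u v, cvg_haar (off_coef R u v)) -> forall x, cvg_haar x.
Proof.
move=> hA hB x; rewrite [x]KP_basis_sum; apply: cvg_haar_sum => -[] [i j] /=.
  by rewrite unit_e_span; apply: cvg_haar_sum => p; exact: hA.
by rewrite unit_E_span; apply: cvg_haar_sum => v; exact: hB.
Qed.

Lemma cvg_haar_coef_comb y u v :
  y != 0 -> cvg_haar (coef_comb y u v) ->
  cvg_haar (coef_comb (- y) u v) ->
  cvg_haar (diag_coef R u v) /\ cvg_haar (off_coef R u v).
Proof.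
move=> y0 h1 h2; split.
  have -> : diag_coef R u v = 2^-1 *: (coef_comb y u v + coef_comb (- y) u v).
    rewrite /coef_comb addrACA -scalerDl subrr scale0r addr0 scalerDr -scalerDl.
    by rewrite (_ : 2^-1 + 2^-1 = 1) ?scale1r //; field.
  exact/cvg_haarZ/cvg_haarD.
have -> : off_coef R u v = (2 * y)^-1 *: (coef_comb y u v + (-1) *: coef_comb (- y) u v).
  rewrite /coef_comb scaleN1r opprD addrACA subrr add0r scaleNr opprK -scalerDl scalerA.
  by rewrite (_ : _ * _ = 1) ?scale1r //; field.
exact/cvg_haarZ/cvg_haarD/cvg_haarZ.
Qed.

Lemma irr_dim_gt0 al : 0 < (@irr_dim n al)%:R :> C.
Proof. by case: al => *; rewrite /= ltr0n. Qed.

Lemma norm_coef al : (`|c al / (irr_dim al)%:R| < 1) = (`|c al| < (irr_dim al)%:R).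
Proof.
by rewrite normrM normfV (gtr0_norm (irr_dim_gt0 al)) ltr_pdivrMr ?irr_dim_gt0 // mul1r.
Qed.

(** The walk takes as values here the powers of c_al / d_al. The target is 0, reached exactly when
    the modulus is below 1, except at the unit, where both sides equal 1. *)
Lemma cvg_haar_dual_coef al : cvg_haar (dual_coef R al) <->
  (al != irr_unit -> `|c al| < (irr_dim al)%:R).
Proof.
rewrite /cvg_haar haar_dual_coef -norm_coef.
rewrite (_ : (fun k => _) = (fun k => (c al / (irr_dim al)%:R) ^+ k)); last first.
  by apply/funext => k; exact: conv_pow_dual_coef.
have [->|hal] := eqVneq al irr_unit.
  rewrite coef_unit divr1 (_ : (fun k => _) = (fun=> 1)); last first.
    by apply/funext => k; rewrite expr1n.
  by split=> // _; exact: cvg_cst.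
split=> [h _|h]; first exact: expr_cvg0_lt1.
exact/expr_cvg0/h.
Qed.

Lemma walk_cvg : dual_cvg (conv_pow phi) (@haar R n) <->
  (forall al, al != irr_unit -> `|c al| < (irr_dim al)%:R).
Proof.
split=> [h al|h]; first exact/cvg_haar_dual_coef/h.
have ht al : cvg_haar (dual_coef R al) by apply/cvg_haar_dual_coef/h.
suff hAB u v : cvg_haar (diag_coef R u v) /\ cvg_haar (off_coef R u v).
  by apply: cvg_haar_all => u v; have [] := hAB u v.
have [->|[ev ->]|[k [hk hv]]] := Zp_cases hn v.
- apply: (@cvg_haar_coef_comb 1); first exact: oner_neq0.
    by have := ht (Rho false (- u)); rewrite /dual_coef opprK expr0.
  by have := ht (Rho true (- u)); rewrite /dual_coef opprK expr1.
(* This y is the phase in the dual elements of [Sigma] with l = - u; the two signs supply y and -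
   y. *)
- apply: (@cvg_haar_coef_comb (w (- u * Zhalf))); first exact: (eta_exp_neq0 R hn).
    by have := ht (Sigma ev false (- u)); rewrite /dual_coef opprK expr0 mul1r.
  by have := ht (Sigma ev true (- u)); rewrite /dual_coef opprK expr1 mulN1r.
have k2 : k%:R + k%:R != 0 :> 'Z_n by exact: natZp_add_neq0.
have v2 : v + v != 0 by case: hv => ->; rewrite // -opprD oppr_eq0.
have [hA hB] := haar_coef_eq0 u v2; split; last first.
  rewrite /cvg_haar hB (_ : (fun k => _) = (fun=> 0)); first exact: cvg_cst.
  by apply/funext => m; apply: (conv_pow_off_coef hn fourier_scalar) => // u';
    exact: fourier_off_coef.
have h1 : cvg_haar (diag_coef R u k%:R).
  by have := ht (Xuv (- u) hk); rewrite /dual_coef opprK coef_comb0.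
case: hv v2 hA => -> v2 hA; first exact: h1.
have [h0 _] := haar_coef_eq0 u k2.
(* Only k itself indexes an irreducible; the case v = - k follows from the symmetry of phi, as both
   values are m-th powers of the same scalar. *)
have hf m : conv_pow phi m (diag_coef R u (- k%:R)) = conv_pow phi m (diag_coef R u k%:R).
  have eN := @conv_pow_diag_coef R n hn phi fourier_scalar m u _
    (@fourier_off_coef u) v2.
  have eP := @conv_pow_diag_coef R n hn phi fourier_scalar m u _
    (@fourier_off_coef u) k2.
  have e := congr1 (fun z => z ^+ m) (fourier_diag_coef_opp u k2).
  exact (etrans eN (etrans e (esym eP))).
rewrite /cvg_haar hA (funext hf).
by move: h1; rewrite /cvg_haar h0.
Qed.
End Walk.
End RandomWalk.

Theorem theorem3p2 (R : realType) (n : nat) (hn : (2 <= n)%N)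
    (a : KP R n) (c : KP_irr n -> R[i])
    (ha : a = \sum_(al : KP_irr n) c al *: irr_char al)
    (hstate : is_state (fourier a)) :
  dual_cvg (conv_pow (fourier a)) (@haar R n)
  <-> (forall al : KP_irr n, al != irr_unit -> `|c al| < (irr_dim al)%:R).
Proof. exact: walk_cvg. Qed.
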